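(* There exists a unital, completely positive, idempotent linear map $\Phi:\ell^\infty(\mathbb Z)\to\ell^\infty(\mathbb Z)$ commuting with the backward shift $B$, whose range is a C*-subalgebra of $\ell^\infty(\mathbb Z)$, such that $\Phi$ is not a homomorphism, $\Phi(c_0(\mathbb Z))=0$, and $\sigma(\Phi)$ is a dense, proper subgroup of $\mathbb T$.
   Context: $(Bv)_n=v_{n+1}$; $c_0(\mathbb Z)$ is the space of null sequences. For $\lambda\in\mathbb T$, $x_\lambda=(\lambda^n)_n$; any linear $\Phi$ commuting with $B$ satisfies $\Phi(x_\lambda)=c_\lambda x_\lambda$ for a scalar $c_\lambda$, and $\sigma(\Phi)=\{\lambda\in\mathbb T:c_\lambda\ne0\}$. *)

(* Defs.v *)
(* complex numbers C := R[i] = complex R over an abstract realType R. *)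
From HB Require Import structures.
From mathcomp Require Import all_boot all_order all_algebra.
From mathcomp Require Import complex.
From mathcomp Require Import reals.
Set Implicit Arguments. Unset Strict Implicit. Unset Printing Implicit Defensive.
Import Order.TTheory GRing.Theory Num.Theory.
Local Open Scope ring_scope.

Section L.
Variable R : realType.
Local Notation C := (R[i]).
Local Notation seqZ := (int -> C).

(* v is in l^oo(Z) *)
Definition bounded (v : seqZ) : Prop := exists M : C, forall n, `|v n| <= M.

(* v is in c_0(Z) *)
Definition null_seq (v : seqZ) : Prop :=
  forall eps : C, 0 < eps -> exists N : int, forall n : int, N <= `|n| -> `|v n| < eps.

(* backward shift (Bv)_n = v_{n+1} *)
Definition shiftB (v : seqZ) : seqZ := fun n => v (n + 1).

(* x_lambda = (lambda^n)_n *)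
Definition xl (lam : C) : seqZ := fun n => lam ^ n.

Variable Phi : seqZ -> seqZ.

Definition maps_linf : Prop := forall v, bounded v -> bounded (Phi v).

Definition linear_linf : Prop := forall (a : C) u v, bounded u -> bounded v ->
  Phi (fun n => a * u n + v n) = (fun n => a * Phi u n + Phi v n).

Definition unital : Prop := Phi (fun _ => 1) = (fun _ => 1).

Definition idempotent_linf : Prop := forall v, bounded v -> Phi (Phi v) = Phi v.

Definition commutes_B : Prop := forall v, bounded v -> Phi (shiftB v) = shiftB (Phi v).

(* positive semidefinite n x n complex matrix *)
Definition psd (n : nat) (A : 'I_n -> 'I_n -> C) : Prop :=
  forall w : 'I_n -> C, 0 <= \sum_(i < n) \sum_(j < n) (w i)^* * A i j * w j.

(* An element A of M_n(l^oo(Z)) = l^oo(Z, M_n(C)) is positive iff A(k) is psd for every k.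
   Complete positivity: every amplification Phi_n is positive. *)
Definition completely_positive : Prop :=
  forall (n : nat) (A : 'I_n -> 'I_n -> seqZ),
    (forall i j, bounded (A i j)) ->
    (forall k : int, psd (fun i j => A i j k)) ->
    (forall k : int, psd (fun i j => Phi (A i j) k)).

Definition in_range (w : seqZ) : Prop := exists v, bounded v /\ Phi v = w.

(* the range is a C*-subalgebra of l^oo(Z): a norm-closed *-subalgebra *)
Definition range_Cstar_subalgebra : Prop :=
  in_range (fun _ => 0) /\
  (forall (a : C) u v, in_range u -> in_range v -> in_range (fun n => a * u n + v n)) /\
  (forall u v, in_range u -> in_range v -> in_range (fun n => u n * v n)) /\
  (forall u, in_range u -> in_range (fun n => (u n)^*)) /\
  (forall w, bounded w ->
        (forall eps : C, 0 < eps ->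
           exists u, in_range u /\ forall n, `|w n - u n| <= eps) ->
        in_range w).

Definition homomorphism : Prop :=
  forall u v, bounded u -> bounded v ->
    Phi (fun n => u n * v n) = (fun n => Phi u n * Phi v n).

Definition kills_c0 : Prop := forall v, bounded v -> null_seq v -> Phi v = (fun _ => 0).

(* c_lambda: Phi(x_lambda) = c_lambda x_lambda, and x_lambda(0) = 1 *)
Definition coefc (lam : C) : C := Phi (xl lam) 0.

(* sigma(Phi) = { lambda in T : c_lambda <> 0 } *)
Definition sigmaPhi (lam : C) : Prop := `|lam| = 1 /\ coefc lam != 0.

End L.

Definition dense_proper_subgroup_T (R : realType) (S : R[i] -> Prop) : Prop :=
  (forall lam, S lam -> `|lam| = 1) /\
      S 1 /\
      (forall a b, S a -> S b -> S (a * b)) /\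
      (forall a, S a -> S (a^-1)) /\
      (forall mu : R[i], `|mu| = 1 -> forall eps : R[i], 0 < eps ->
         exists lam, S lam /\ `|lam - mu| < eps) /\
      (exists mu : R[i], `|mu| = 1 /\ ~ S mu).

(* Main.v *)
(* Call v dyadic if it is 2^k-periodic for some k.  Among the shift-equivariant
   positive unital maps of real l^oo(Z) that fix every dyadic sequence and kill
   c_0 and the 3-periodic sequences of mean zero, Zorn's lemma gives a minimal
   one phi for the preorder "||psi v|| <= ||phi v|| for all v"; comparing phi
   with the Cesaro means of its iterates shows that a minimal map is idempotent.

   The sequences f >= 0 with phi f = 0 tend to 0 along an ultrafilter U on Z
   that contains every 2^k Z.  Put rho v n := lim_(m -> U) v(n + m), an
   equivariant homomorphism.  Then rho o phi is dominated by phi, hence is again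
   minimal and so idempotent.  For w = phi u Kadison's inequality gives
   phi(w^2) - w^2 >= 0, which phi kills, so rho(w^2) = rho(phi(w^2)):
   the range of rho o phi is closed under products.

   After complexification lambda lies in sigma iff x_lambda lies in the range, so
   sigma is a subgroup; it contains the 2^k-th roots of unity and omits the
   primitive cube root of unity omega.  As x_omega is killed although
   x_omega x_(1/omega) = 1, the map is not a homomorphism. *)
From HB Require Import structures.
From mathcomp Require Import all_boot all_order all_algebra.
From mathcomp Require Import complex.
From mathcomp Require Import all_classical all_reals all_analysis.
From mathcomp Require Import ring lra zify.
Require Import Defs.
Import Order.TTheory GRing.Theory Num.Theory.
Import numFieldNormedType.Exports.
Local Open Scope classical_set_scope.
Local Open Scope ring_scope.

(** * Limits of bounded real families along an ultrafilter *)

Section UltrafilterLimit.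
Context {R : realType} {I : Type} (U : set_system I) {UU : UltraFilter U}.

(** Compactness of [[-M, M]] yields a cluster point, and an ultrafilter converges to each of its
    cluster points. *)
Lemma ultra_bounded_cvg (f : I -> R) (M : R) :
  (forall i, `|f i| <= M) -> cvg (f @ U).
Proof.
move=> fM.
have FM : (f @ U) `[- M, M]%classic.
  rewrite /fmap /=; apply: (@filterE _ U) => i; have := fM i.
  by rewrite ler_norml /= in_itv.
have [p [_ clp]] := @segment_compact R (- M) M (f @ U) _ FM.
apply/cvg_ex; exists p => A nA; have [//|UnA] := in_ultra_setVsetC (f @^-1` A) UU.
by have [x [/= nAx Ax]] := clp (~` A) A UnA nA.
Qed.

End UltrafilterLimit.

(** * Positive unital shift-equivariant operators on real bounded sequences *)

Section Operators.
Context {R : realType}.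
Implicit Types (v u w : int -> R) (phi psi : (int -> R) -> int -> R).

Definition bnd v := exists M, forall n, `|v n| <= M.

Lemma bnd_lin (a : R) u v : bnd u -> bnd v -> bnd (fun n => a * u n + v n).
Proof.
move=> [M uM] [N vN]; exists (`|a| * M + N) => n.
by rewrite (le_trans (ler_normD _ _))// lerD// normrM ler_wpM2l.
Qed.

Lemma bnd_cst (c : R) : bnd (fun=> c).
Proof. by exists `|c|. Qed.

Lemma bndM u v : bnd u -> bnd v -> bnd (fun n => u n * v n).
Proof.
by move=> [M uM] [N vN]; exists (M * N) => n; rewrite normrM ler_pM.
Qed.

Lemma bnd_translate v m : bnd v -> bnd (fun n => v (n + m)).
Proof. by move=> [M vM]; exists M. Qed.

(** Operators are total functions on all sequences, but the axioms constrain their values on bounded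
    sequences only. *)
Record equivariant_state phi : Prop := EquivariantState {
  es_lin : forall (a : R) u v, bnd u -> bnd v ->
    phi (fun n => a * u n + v n) = (fun n => a * phi u n + phi v n);
  es_ge0 : forall v, bnd v -> (forall n, 0 <= v n) -> forall n, 0 <= phi v n;
  es_shift : forall v, bnd v -> phi (fun n => v (n + 1)) = (fun n => phi v (n + 1));
  es_one : phi (fun=> 1) = (fun=> 1) }.

Section Theory.
Variable phi : (int -> R) -> int -> R.
Hypothesis phiE : equivariant_state phi.

Lemma es0 : phi (fun=> 0) = (fun=> 0).
Proof.
have := es_lin _ phiE (-1) _ _ (bnd_cst 0) (bnd_cst 0).
under eq_fun do rewrite mulr0 addr0.
by move=> ->; apply/funext => n; rewrite mulN1r addNr.
Qed.

Lemma esZ a v : bnd v -> phi (fun n => a * v n) = (fun n => a * phi v n).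
Proof.
move=> vb; have := es_lin _ phiE a _ _ vb (bnd_cst 0).
under eq_fun do rewrite addr0.
by move=> ->; rewrite es0; under eq_fun do rewrite addr0.
Qed.

Lemma esD u v : bnd u -> bnd v ->
  phi (fun n => u n + v n) = (fun n => phi u n + phi v n).
Proof.
move=> ub vb; have := es_lin _ phiE 1 _ _ ub vb.
by under eq_fun do rewrite mul1r; move=> ->; under eq_fun do rewrite mul1r.
Qed.

Lemma esB u v : bnd u -> bnd v ->
  phi (fun n => u n - v n) = (fun n => phi u n - phi v n).
Proof.
move=> ub vb; have := es_lin _ phiE (-1) _ _ vb ub.
under eq_fun do rewrite mulN1r addrC.
by move=> ->; under eq_fun do rewrite mulN1r addrC.
Qed.

Lemma es_cst c : phi (fun=> c) = (fun=> c).
Proof.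
have := esZ c _ (bnd_cst 1); rewrite (es_one _ phiE).
by under eq_fun do rewrite mulr1.
Qed.

Lemma es_le u v : bnd u -> bnd v -> (forall n, u n <= v n) ->
  forall n, phi u n <= phi v n.
Proof.
move=> ub vb uv n; rewrite -subr_ge0.
have -> : phi v n - phi u n = phi (fun n => v n - u n) n by rewrite esB.
apply: (es_ge0 _ phiE) => [|k]; last by rewrite subr_ge0.
have := bnd_lin (-1) _ _ ub vb.
by under eq_fun do rewrite mulN1r addrC.
Qed.

Lemma es_norm_le v M : (forall n, `|v n| <= M) -> forall n, `|phi v n| <= M.
Proof.
move=> vM n; have vb : bnd v by exists M.
have H := es_cst M; have H' := es_cst (- M).
rewrite ler_norml; apply/andP; split.
  rewrite -[leLHS]/((fun=> - M) n) -H'.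
  apply: es_le => [||k]; [exact: bnd_cst|exact: vb|].
  by have := vM k; rewrite ler_norml => /andP[].
rewrite -[leRHS]/((fun=> M) n) -H.
apply: es_le => [||k]; [exact: vb|exact: bnd_cst|].
by have := vM k; rewrite ler_norml => /andP[].
Qed.

Lemma es_bnd v : bnd v -> bnd (phi v).
Proof. by move=> [M vM]; exists M; exact: es_norm_le. Qed.

Lemma es_translate v m : bnd v ->
  phi (fun n => v (n + m)) = (fun n => phi v (n + m)).
Proof.
have pos k : bnd v -> phi (fun n => v (n + k%:Z)) = (fun n => phi v (n + k%:Z)).
  move=> vb; elim: k => [|k IH].
    by under eq_fun do rewrite addr0; under [RHS]eq_fun do rewrite addr0.
  have := es_shift _ phiE (fun n => v (n + k%:Z)) (bnd_translate _ _ vb).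
  rewrite IH.
  have E n : n + k.+1%:Z = n + 1 + k%:Z by lia.
  by under eq_fun do rewrite -E; move=> ->; under eq_fun do rewrite -E.
case: m => k vb; first exact: pos.
apply/funext => n.
have E x : x + Negz k + k.+1%:Z = x by lia.
pose u := fun n => v (n + Negz k).
have ub : bnd u by exact: bnd_translate.
(* A backward translation is undone by a forward one: the forward case for the translate [u], read
   at [n + Negz k], gives the claim. *)
suff : phi (fun n => u (n + k.+1%:Z)) = (fun n => phi u (n + k.+1%:Z)).
  have E' x : x + k.+1%:Z + Negz k = x by lia.
  rewrite /u; under eq_fun do rewrite E'.
  by move=> /(congr1 (fun f => f (n + Negz k))) ->; rewrite E.
elim: k.+1 u ub {E} => [|j IH] u ub.
  by under eq_fun do rewrite addr0; under [RHS]eq_fun do rewrite addr0.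
have := es_shift _ phiE (fun n => u (n + j%:Z)) (bnd_translate _ _ ub).
rewrite IH //.
have E x : x + j.+1%:Z = x + 1 + j%:Z by lia.
by under eq_fun do rewrite -E; move=> ->; under eq_fun do rewrite -E.
Qed.

(** Kadison's inequality: positivity is applied to the square of [v - t], where the constant [t] is
    the value [phi v n] at the very point of evaluation. *)
Lemma es_sqr_le v : bnd v -> forall n, phi v n ^+ 2 <= phi (fun k => v k ^+ 2) n.
Proof.
move=> vb n; set t := phi v n.
have v2b : bnd (fun k => v k ^+ 2) by exact: bndM.
pose u := fun k => (- (2 * t)) * v k + (t ^+ 2 + v k ^+ 2).
have t2b : bnd (fun k => t ^+ 2 + v k ^+ 2).
  by have := bnd_lin 1 _ _ (bnd_cst (t ^+ 2)) v2b; under eq_fun do rewrite mul1r.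
have ub : bnd u by exact: bnd_lin.
have : 0 <= phi u n.
  by apply: (es_ge0 _ phiE) => // k; rewrite /u; have := sqr_ge0 (v k - t); nra.
rewrite /u es_lin // esD //; last exact: bnd_cst.
by rewrite es_cst -/t; nra.
Qed.

End Theory.

Lemma es_comp phi psi : equivariant_state phi -> equivariant_state psi ->
  equivariant_state (psi \o phi).
Proof.
move=> Hf Hp; split => /=.
- by move=> a u v ub vb; rewrite (es_lin _ Hf) ?(es_lin _ Hp) //; exact: es_bnd.
- move=> v vb v0; apply: (es_ge0 _ Hp); first exact: es_bnd.
  exact: (es_ge0 _ Hf).
- by move=> v vb; rewrite (es_shift _ Hf) // (es_shift _ Hp) //; exact: es_bnd.
- by rewrite (es_one _ Hf) (es_one _ Hp).
Qed.

Lemma es_avg (N : nat) (F : nat -> (int -> R) -> int -> R) : (0 < N)%N ->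
  (forall k, equivariant_state (F k)) ->
  equivariant_state (fun v n => (\sum_(k < N) F k v n) / N%:R).
Proof.
move=> N0 HF; have N0' : (N%:R : R) != 0 by rewrite pnatr_eq0 -lt0n.
split.
- move=> a u v ub vb; apply/funext => n.
  under eq_bigr do rewrite (es_lin _ (HF _)) //.
  by rewrite big_split /= -mulr_sumr mulrDl mulrA.
- move=> v vb v0 n; rewrite divr_ge0 // sumr_ge0 // => k _.
  exact: (es_ge0 _ (HF k)).
- move=> v vb; apply/funext => n; congr (_ / _).
  by apply: eq_bigr => k _; rewrite (es_shift _ (HF k)).
- apply/funext => n; under eq_bigr do rewrite (es_one _ (HF _)).
  by rewrite sumr_const card_ord -[1 *+ N]/(N%:R) divff.
Qed.

(** Every [F i] is contractive, so the values at a bounded sequence stay bounded and each [lim] is a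
    genuine limit. *)
Lemma es_ulim (I : Type) (U : set_system I) {UU : UltraFilter U}
    (F : I -> (int -> R) -> int -> R) :
  (forall i, equivariant_state (F i)) ->
  equivariant_state (fun v n => lim (F i v n @[i --> U])).
Proof.
move=> HF.
have cF v n : bnd v -> cvg (F i v n @[i --> U]).
  by move=> [M vM]; apply: (@ultra_bounded_cvg _ _ U _ _ M) => i; exact: es_norm_le.
split.
- move=> a u v ub vb; apply/funext => n.
  under eq_fun do rewrite (es_lin _ (HF _)) //.
  by apply/cvg_lim => //; apply: cvgD; [apply: cvgMr|]; exact: cF.
- move=> v vb v0 n; apply: limr_ge; first exact: cF.
  by apply: filterE => i; exact: (es_ge0 _ (HF i)).
- move=> v vb; apply/funext => n.
  by under eq_fun do rewrite (es_shift _ (HF _)) //.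
- apply/funext => n; under eq_fun do rewrite (es_one _ (HF _)).
  by apply/cvg_lim => //; exact: cvg_cst.
Qed.

Lemma es_translation m : equivariant_state (fun v n => v (n + m)).
Proof.
split=> // v vb; apply/funext => n; congr v; lia.
Qed.

End Operators.

(** * Admissible operators: existence, minimal elements, idempotence *)

Section Admissible.
Context {R : realType}.
Implicit Types (v u w : int -> R) (phi psi : (int -> R) -> int -> R).

Definition dyadic v := exists k : nat, forall n, v (n + 2 ^+ k) = v n.

Definition vanishing v :=
  forall eps, 0 < eps -> exists N : int, forall n : int, N <= `|n| -> `|v n| < eps.

(** Reads: [v] has to be sent to the second argument. A single relation lets averages, limits and
    compositions preserve all three requirements by one argument. Vanishing of all three-term sums
    encodes 3-periodicity with mean zero. *)
Inductive prescribed v : (int -> R) -> Prop :=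
| prescribed_dyadic of dyadic v : prescribed v v
| prescribed_vanishing of vanishing v : prescribed v (fun=> 0)
| prescribed_period3 of (forall n, v n + v (n + 1) + v (n + 2) = 0) :
    prescribed v (fun=> 0).

Definition fixes_dyadic phi := forall v, bnd v -> dyadic v -> phi v = v.

Definition admissible phi :=
  equivariant_state phi /\ forall v w, bnd v -> prescribed v w -> phi v = w.

Lemma dyadic_cst c : dyadic (fun=> c).
Proof. by exists 0%N. Qed.

Lemma dyadic_dvd v k j (m : nat) : (k <= j)%N ->
  (forall n, v (n + 2 ^+ k) = v n) -> forall n, v (n + m%:Z * 2 ^+ j) = v n.
Proof.
move=> kj vk.
have {}vk (i : nat) n : v (n + i%:Z * 2 ^+ k) = v n.
  elim: i n => [|i IH] n; first by rewrite mul0r addr0.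
  by rewrite -[RHS]IH -[RHS]vk; congr v; rewrite intS; ring.
move=> n; rewrite -(subnK kj) exprD mulrA -[RHS](vk (m * 2 ^ (j - k))%N).
by congr (v (_ + _ * _)); rewrite PoszM -natrX natz.
Qed.

Lemma prescribed_target_dyadic v w : prescribed v w -> dyadic w.
Proof. by case=> // _; exact: dyadic_cst. Qed.

Lemma prescribed_target_bnd v w : bnd v -> prescribed v w -> bnd w.
Proof. by move=> vb [] // _; exact: bnd_cst. Qed.

Lemma admissible_fixes phi : admissible phi -> fixes_dyadic phi.
Proof. by move=> [_ H] v vb vd; apply: H => //; constructor. Qed.

(** All prescribed values are themselves dyadic, so [psi] leaves what [phi] produces unchanged. *)
Lemma admissible_comp phi psi : admissible phi -> equivariant_state psi ->
  fixes_dyadic psi -> admissible (psi \o phi).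
Proof.
move=> [phiE phiP] psiE psiD; split; first exact: es_comp.
move=> v w vb vw /=; rewrite (phiP _ _ vb vw); apply: psiD.
  exact: prescribed_target_bnd vb vw.
exact: prescribed_target_dyadic vw.
Qed.

(** Since 2^k is prime to 3, the three indices still meet every residue mod 3. With S(n) the sum for
    step d, the sum for step 2d is S(n) - S(n+d) + S(n+2d). *)
Lemma period3_doubling (k : nat) v : (forall n, v n + v (n + 1) + v (n + 2) = 0) ->
  forall n, v n + v (n + 2 ^+ k) + v (n + 2 * 2 ^+ k) = 0.
Proof.
move=> v3; elim: k => [|k IH] n; first by rewrite expr0 mulr1; exact: v3.
have := IH n; have := IH (n + 2 ^+ k).
rewrite exprS.
have -> : n + 2 ^+ k + 2 ^+ k = n + 2 * 2 ^+ k :> int by ring.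
have -> : n + 2 ^+ k + 2 * 2 ^+ k = n + 3 * 2 ^+ k :> int by ring.
have := IH (n + 2 * 2 ^+ k).
have -> : n + 2 * 2 ^+ k + 2 ^+ k = n + 3 * 2 ^+ k :> int by ring.
have -> : n + 2 * 2 ^+ k + 2 * 2 ^+ k = n + 2 * (2 * 2 ^+ k) :> int by ring.
lra.
Qed.

(** The step 2^k makes all terms equal on sequences of period 2^j with j at most k; a number of
    terms divisible by 3 lets period-3 sums cancel in blocks; its growth with k sends averages of
    null sequences to 0. *)
Definition dyadic_avg (k : nat) v : int -> R := fun n =>
  (\sum_(m < 3 * k.+1) v (n + m%:Z * 2 ^+ k)) / (3 * k.+1)%:R.

Lemma dyadic_avg_es k : equivariant_state (dyadic_avg k).
Proof.
apply: (es_avg _ (fun m v n => v (n + m%:Z * 2 ^+ k))) => // m.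
exact: es_translation.
Qed.

Lemma dyadic_avg_fix k j v : (k <= j)%N -> (forall n, v (n + 2 ^+ k) = v n) ->
  dyadic_avg j v = v.
Proof.
move=> kj vk; apply/funext => n; rewrite /dyadic_avg.
under eq_bigr do rewrite (dyadic_dvd v k j _ kj vk).
by rewrite sumr_const card_ord -[v n *+ _]mulr_natr mulfK // pnatr_eq0.
Qed.

Lemma dyadic_avg_period3 k v : (forall n, v n + v (n + 1) + v (n + 2) = 0) ->
  dyadic_avg k v = (fun=> 0).
Proof.
move=> v3; apply/funext => n; rewrite /dyadic_avg.
suff -> (N : nat) : \sum_(m < 3 * N) v (n + m%:Z * 2 ^+ k) = 0 by rewrite mul0r.
elim: N => [|N IH]; first by rewrite muln0 big_ord0.
have -> : (3 * N.+1 = (3 * N).+3)%N by lia.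
rewrite !big_ord_recr /= IH add0r.
rewrite -[RHS](period3_doubling k v v3 (n + (3 * N)%N%:Z * 2 ^+ k)).
congr (_ + v _ + v _); rewrite -addrA; congr (_ + _).
  by rewrite intS; ring.
by rewrite !intS; ring.
Qed.

Lemma dyadic_avg_vanishing v n : bnd v -> vanishing v ->
  dyadic_avg k v n @[k --> \oo] --> (0 : R).
Proof.
move=> [M vM] v0; apply/cvgrPdist_le => e e0.
have e20 : 0 < e / 2 by lra.
have [N vN] := v0 _ e20.
have M0 : 0 <= M by apply: le_trans (vM 0).
near=> k.
rewrite sub0r normrN /dyadic_avg normrM normfV.
have K0 : 0 < (3 * k.+1)%:R :> R by rewrite ltr0n.
rewrite (ger0_norm (ltW K0)) ler_pdivrMr //.
have -> : (3 * k.+1 = (3 * k + 2).+1)%N by lia.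
(* The term m = 0 sits at [n] for every k and is bounded only by [M]; it is split off, and all other
   terms move out to infinity. *)
rewrite big_ord_recl; apply: (le_trans (ler_normD _ _)).
have B : `|\sum_(i < (3 * k + 2)) v (n + (bump 0 i)%:Z * 2 ^+ k)|
    <= (3 * k + 2)%:R * (e / 2).
  apply: (le_trans (ler_norm_sum _ _ _)).
  have -> : (3 * k + 2)%:R * (e / 2) = \sum_(i < (3 * k + 2)) (e / 2).
    by rewrite sumr_const card_ord mulr_natl.
  apply: ler_sum => i _; apply/ltW/vN.
  (* This puts every index [n + m * 2 ^+ k] with m at least 1 beyond [N] in absolute value. *)
  have H : N + `|n| <= 2 ^+ k.
    have Hk : (absz (N + `|n|)%R <= k)%N by near: k; exact: nbhs_infty_ge.
    have := ltn_expl k (isT : 1 < 2)%N; rewrite -natrX natz; lia.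
  have : 1 * 2 ^+ k <= (bump 0 i)%:Z * 2 ^+ k :> int.
    by rewrite ler_wpM2r // exprn_ge0.
  rewrite mul1r; lia.
have C := vM (n + 0%N%:Z * 2 ^+ k).
apply: (le_trans (lerD C B)).
(* For such k the exceptional term is at most k * e / 2, which fits in the slack left by the other
   terms. *)
have Hk : M / (e / 2) <= k%:R by near: k; exact: nbhs_infty_ger.
have {}Hk : M <= k%:R * (e / 2) by rewrite -ler_pdivrMr.
have : (3 * k + 2).+1%:R = 3 * k%:R + 3 :> R by rewrite -natr1 natrD natrM; ring.
have : (3 * k + 2)%:R = 3 * k%:R + 2 :> R by rewrite natrD natrM.
have k0 : 0 <= k%:R :> R by [].
move=> -> ->; nra.
Unshelve. all: by end_near. Qed.

(** An ultrafilter limit of the averages works: dyadic sequences are fixed for large k, period-3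
    sums vanish for every k, and null sequences average to 0 in the limit. *)
Lemma admissible_exists : exists phi, admissible phi.
Proof.
have [U [UU sU]] := ultraFilterLemma (F := \oo) _.
exists (fun v n => lim (dyadic_avg k v n @[k --> U])).
split; first by apply: es_ulim => k; exact: dyadic_avg_es.
move=> v w vb vw; apply/funext => n; apply/cvg_lim => //.
case: vw => [[k vk]|v0|v3].
- apply: cvg_near_cst; apply: sU; exists k => // j /= kj.
  by rewrite (dyadic_avg_fix k).
- move=> A nA; apply: sU; exact: (dyadic_avg_vanishing v n vb v0 A nA).
- by apply: cvg_near_cst; apply: filterE => k; rewrite dyadic_avg_period3.
Qed.

(** The sup-norm comparison of [phi v] with [psi v], expressed through upper bounds [M] instead of a
    supremum. *)
Definition dominated phi psi := forall v M, bnd v ->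
  (forall n, `|psi v n| <= M) -> forall n, `|phi v n| <= M.

Definition minimal phi := admissible phi /\
  forall psi, admissible psi -> dominated psi phi -> dominated phi psi.

Lemma dominated_trans phi1 phi2 phi3 :
  dominated phi1 phi2 -> dominated phi2 phi3 -> dominated phi1 phi3.
Proof. by move=> H1 H2 v M vb H; apply: H1 => //; exact: H2. Qed.

Lemma minimal_exists : exists phi, minimal phi.
Proof.
have [phi0 adm0] := admissible_exists.
pose T := {phi | admissible phi}.
(* The order is reversed, so that a maximal element from Zorn's lemma is minimal for domination. *)
pose r (s t : T) : bool := `[< dominated (sval t) (sval s) >].
have [|||t tmin] := @ZL_preorder T (exist _ phi0 adm0) r.
- by move=> t; apply/asboolP => v M.
- move=> s t u /asboolP st /asboolP tu; apply/asboolP.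
  exact: dominated_trans tu st.
- move=> A Atot; have [[a0 Aa0]|A0] := pselect (A !=set0); last first.
    by exists (exist _ phi0 adm0) => s As; exfalso; apply: A0; exists s.
  (* The tails of the chain form a filter base. The pointwise limit along an ultrafilter containing
     all tails is a lower bound of the chain. *)
  pose B (a : T) : set T := [set s | A s /\ r a s].
  have rr a : r a a by apply/asboolP => v M.
  have FF : ProperFilter (filter_from A B).
    apply: filter_from_proper; last by move=> a Aa; exists a; split.
    apply: filter_from_filter; first by exists a0.
    move=> a b Aa Ab; have [/asboolP ab|/asboolP ba] := Atot _ _ Aa Ab.
      exists b => // s [As /asboolP bs]; split; split=> //; apply/asboolP => //.
      exact: dominated_trans bs ab.
    exists a => // s [As /asboolP bs]; split; split=> //; apply/asboolP => //.
    exact: dominated_trans bs ba.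
  have [U [UU sU]] := ultraFilterLemma FF.
  pose phi v n := lim ((fun s : T => sval s v n) @ U).
  have phiE : equivariant_state phi.
    by apply: es_ulim => s; case: (svalP s).
  have phiA : admissible phi.
    split=> // v w vb vw; apply/funext => n; apply/cvg_lim => //.
    apply: cvg_near_cst; apply: (@filterE _ U) => s.
    by rewrite (proj2 (svalP s) _ _ vb vw).
  exists (exist _ phi phiA) => a Aa; apply/asboolP => v M vb aM n /=.
  have [L vL] := vb.
  have cF : cvg ((fun s : T => sval s v n) @ U).
    apply: (@ultra_bounded_cvg _ _ U _ _ L) => s.
    by apply: es_norm_le => //; case: (svalP s).
  (* On the tail below [a] the bound [M] holds throughout, and a closed bound survives the limit. *)
  have near_M : U [set s : T | `|sval s v n| <= M].
    apply: sU; exists a => // s [As /asboolP as_]; exact: as_.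
  rewrite ler_norml; apply/andP; split.
    by apply: limr_ge => //; apply: filterS near_M => s; rewrite /= ler_norml => /andP[].
  by apply: limr_le => //; apply: filterS near_M => s; rewrite /= ler_norml => /andP[].
exists (sval t); split=> [|psi psiA dpsi]; first exact: svalP.
by have /asboolP := tmin (exist _ psi psiA) (asboolT dpsi).
Qed.

Lemma minimal_dominated phi psi : minimal phi -> admissible psi ->
  dominated psi phi -> minimal psi.
Proof.
move=> [phiA phimin] psiA d; split=> // chi chiA dchi.
exact: dominated_trans d (phimin _ chiA (dominated_trans _ _ _ dchi d)).
Qed.

(** On [y = v - phi v] the Cesaro mean of N+1 iterates telescopes to norm at most 2M/(N+1). That
    mean is admissible and dominated by [phi], so minimality gives [phi y] the same bound for every
    N, whence [phi y = 0]. *)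
Lemma minimal_idempotent phi : minimal phi ->
  forall v, bnd v -> phi (phi v) = phi v.
Proof.
move=> [phiA phimin] v vb; have [phiE _] := phiA.
(* Iterates start at [phi] itself: the identity does not kill null sequences and so is not
   admissible. *)
have itA k : admissible (iter k.+1 phi).
  elim: k => [//|k IH]; apply: admissible_comp => //.
  exact: admissible_fixes.
have itD k : dominated (iter k.+1 phi) phi.
  by elim: k => [//|k IH] u M ub uM; apply: (es_norm_le phi phiE); exact: IH.
pose F k := iter k.+1 phi.
have avgA N : admissible (fun u n => (\sum_(k < N.+1) F k u n) / N.+1%:R).
  split; first by apply: es_avg => // k; case: (itA k).
  move=> u w ub uw; apply/funext => n.
  under eq_bigr do rewrite /F (proj2 (itA _) _ _ ub uw).
  by rewrite sumr_const card_ord -[w n *+ _]mulr_natr mulfK // pnatr_eq0.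
have avgD N : dominated (fun u n => (\sum_(k < N.+1) F k u n) / N.+1%:R) phi.
  move=> u M ub uM n.
  rewrite normrM normfV [`|N.+1%:R|]ger0_norm // ler_pdivrMr ?ltr0n //.
  apply: (le_trans (ler_norm_sum _ _ _)).
  have -> : M * N.+1%:R = \sum_(k < N.+1) M by rewrite sumr_const card_ord mulr_natr.
  by apply: ler_sum => k _; exact: itD.
have [M vM] := vb.
have phib := es_bnd _ phiE _ vb.
pose y n := v n - phi v n.
have yb : bnd y.
  exists (M + M) => n; rewrite (le_trans (ler_normB _ _)) // lerD //.
  exact: es_norm_le.
have yE n N : \sum_(k < N) F k y n = phi v n - F N v n.
  elim: N n => [|N IH] n; first by rewrite big_ord0 subrr.
  have NE : equivariant_state (F N) by case: (itA N).
  rewrite big_ord_recr /= IH /y (esB _ NE) //.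
  have -> : F N (phi v) = F N.+1 v by rewrite /F -iterSr.
  ring.
have bound N n : `|phi y n| <= (M + M) / N.+1%:R.
  apply: (phimin _ (avgA N) (avgD N)) => // m.
  rewrite yE normrM normfV [`|N.+1%:R|]ger0_norm // ler_wpM2r ?invr_ge0 //.
  rewrite (le_trans (ler_normB _ _)) // lerD //; first exact: es_norm_le.
  by apply: es_norm_le => //; case: (itA N.+1).
have y0 n : phi y n = 0.
  apply/eqP; rewrite -normr_eq0 eq_le normr_ge0 andbT; apply/ler_addgt0Pl => e e0.
  rewrite addr0; near \oo => N.
  apply: (le_trans (bound N n)); rewrite ler_pdivrMr ?ltr0n //.
  have : (M + M) / e <= N%:R by near: N; exact: nbhs_infty_ger.
  rewrite ler_pdivrMr // => H; apply: (le_trans H).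
  by rewrite mulrC ler_wpM2l ?ler_nat // ltW.
apply/funext => n; apply/eqP; rewrite eq_sym -subr_eq0; apply/eqP.
by rewrite -[RHS](y0 n) /y esB.
Unshelve. all: by end_near. Qed.

End Admissible.

(** * Passing to an idempotent whose range is closed under products *)

Section MultiplicativeRange.
Context {R : realType}.
Implicit Types (v u w : int -> R) (phi : (int -> R) -> int -> R).

Lemma dyadic_dvdz v k : (forall n, v (n + 2 ^+ k) = v n) ->
  forall n m, (2 ^+ k %| m)%Z -> v (n + m) = v n.
Proof.
move=> vk n m /dvdzP[c ->]; case: c => c.
  exact: (dyadic_dvd v k k c (leqnn k) vk).
rewrite -(dyadic_dvd v k k c.+1 (leqnn k) vk (n + _)) -addrA -mulrDl.
by congr v; rewrite NegzE addNr mul0r addr0.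
Qed.

Lemma dyadic_dvd_indicator k : dyadic (fun n : int => (2 ^+ k %| n)%Z%:R : R).
Proof. by exists k => n; rewrite rpredDr // dvdzz. Qed.

(** The sets where f < a and 2^k divides m form a filter base. If one were empty, f would dominate a
    times the indicator of 2^k Z, which is dyadic and hence fixed by [phi]; then [phi f] would be at
    least a at 0, although it is 0. *)
Lemma null_ideal_ultrafilter phi : admissible phi ->
  exists2 U : set_system int, UltraFilter U &
    (forall f eps, bnd f -> (forall n, 0 <= f n) -> phi f = (fun=> 0) -> 0 < eps ->
       U [set m | f m < eps]) /\
    (forall k, U [set m | (2 ^+ k %| m)%Z]).
Proof.
move=> phiA; have [phiE _] := phiA.
pose D := [set p : (int -> R) * R * nat |
  [/\ bnd p.1.1, forall n, 0 <= p.1.1 n, phi p.1.1 = (fun=> 0) & 0 < p.1.2]].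
pose B (p : (int -> R) * R * nat) :=
  [set m : int | p.1.1 m < p.1.2 /\ (2 ^+ p.2 %| m)%Z].
have D0 k : D (fun=> 0, 1, k) by split => //=; [exact: bnd_cst|exact: es0].
have FF : ProperFilter (filter_from D B).
  apply: filter_from_proper.
    apply: filter_from_filter; first by exists (fun=> 0, 1, 0%N); exact: D0.
    move=> [[f a] j] [[g b] k] [/= fb f0 phif a0] [/= gb g0 phig b0].
    (* As [f] and [g] are nonnegative, their sum bounds both, so this basic set lies in the
       intersection. *)
    exists (fun n => f n + g n, Num.min a b, maxn j k).
      split=> /=.
      - by have := bnd_lin 1 _ _ fb gb; under eq_fun do rewrite mul1r.
      - by move=> n; rewrite addr_ge0.
      - by rewrite esD // phif phig; apply/funext => n; rewrite addr0.
      - by rewrite lt_min a0 b0.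
    move=> m [/=]; rewrite lt_min => /andP[ma mb] dm; split; split => /=.
    - by apply: le_lt_trans ma; rewrite lerDl.
    - by apply: dvdz_trans dm; rewrite dvdz_exp2l // leq_maxl.
    - by apply: le_lt_trans mb; rewrite lerDr.
    - by apply: dvdz_trans dm; rewrite dvdz_exp2l // leq_maxr.
  move=> [[f a] k] [/= fb f0 phif a0].
  apply: contrapT => /set0P/negP/negPn/eqP B0.
  pose d (n : int) : R := (2 ^+ k %| n)%Z%:R.
  have db : bnd d by exists 1 => n; rewrite /d; case: (_ %| _)%Z; rewrite ?normr1 ?normr0.
  have adb : bnd (fun n => a * d n).
    by have := bnd_lin a _ _ db (bnd_cst 0); under eq_fun do rewrite addr0.
  have : phi (fun n => a * d n) 0 <= phi f 0.
    apply: es_le => // n; rewrite /d; case: (boolP (_ %| _)%Z) => dn.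
      rewrite mulr1 leNgt; apply/negP => fa.
      have : B (f, a, k) n by split.
      by rewrite B0.
    by rewrite mulr0.
  rewrite phif (esZ _ phiE) // (admissible_fixes _ phiA _ db (dyadic_dvd_indicator k)).
  by rewrite /d dvdz0 mulr1 leNgt a0.
have [U [UU sU]] := ultraFilterLemma FF; exists U => //; split.
  move=> f e fb f0 phif e0; apply: sU; exists (f, e, 0%N); first by split.
  by move=> m [].
by move=> k; apply: sU; exists (fun=> 0, 1, k); [exact: D0|move=> m []].
Qed.

Lemma idempotent_state_exists : exists2 T : (int -> R) -> int -> R,
  admissible T &
  (forall v, bnd v -> T (T v) = T v) /\
  (forall u, bnd u -> T u = u -> T (fun n => u n ^+ 2) = (fun n => u n ^+ 2)).
Proof.
have [phi phimin] := @minimal_exists R; have [phiA _] := phimin.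
have [phiE _] := phiA.
have [U UU [Unull Udvd]] := null_ideal_ultrafilter _ phiA.
pose rho v n := lim (v (n + m) @[m --> U]).
have rhoE : equivariant_state rho.
  apply: (es_ulim _ U (fun m v n => v (n + m))) => m; exact: es_translation.
have rhocvg v n : bnd v -> cvg (v (n + m) @[m --> U]).
  by move=> [M vM]; apply: (@ultra_bounded_cvg _ _ U _ _ M) => m.
have rhoD : fixes_dyadic rho.
  move=> v vb [k vk]; apply/funext => n; apply/cvg_lim => //.
  apply: cvg_near_cst; apply: filterS (Udvd k) => m dm.
  exact: (dyadic_dvdz v k).
have rhoX v : bnd v -> rho (fun n => v n ^+ 2) = (fun n => rho v n ^+ 2).
  move=> vb; apply/funext => n; apply/cvg_lim => //.
  by rewrite expr2; apply: cvgM; exact: rhocvg.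
have rho_null h : bnd h -> (forall n, 0 <= h n) -> phi h = (fun=> 0) ->
    rho h = (fun=> 0).
  move=> hb h0 phih; apply/funext => n; apply/cvg_lim => //.
  apply/cvgrPdist_lt => e e0.
  (* By equivariance the translate of [h] by [n] is killed by [phi] as well, so the ultrafilter sees
     it as small too. *)
  have : U [set m | h (m + n) < e].
    apply: (Unull (fun m => h (m + n))) => //; first exact: bnd_translate.
    by rewrite (es_translate _ phiE) // phih.
  by apply: filterS => m /=; rewrite sub0r normrN ger0_norm // addrC.
have TA : admissible (rho \o phi) by exact: admissible_comp.
have Tmin : minimal (rho \o phi).
  apply: minimal_dominated phimin TA _ => v M vb vM.
  exact: (es_norm_le _ rhoE).
have Tidem := minimal_idempotent _ Tmin.
exists (rho \o phi) => //; split=> // u ub Tu.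
pose w := phi u.
have wb : bnd w by exact: es_bnd.
have w2b : bnd (fun n => w n ^+ 2) by exact: bndM.
have pw2b : bnd (phi (fun n => w n ^+ 2)) by exact: es_bnd.
(* Exhibiting the square of [u] in the range suffices, since the operator is idempotent. *)
suff u2 : (rho \o phi) (fun n => w n ^+ 2) = (fun n => u n ^+ 2).
  by rewrite -u2 Tidem.
have -> : (fun n => u n ^+ 2) = rho (fun n => w n ^+ 2) by rewrite rhoX // -[in LHS]Tu.
rewrite /=.
have pw := es_sqr_le _ phiE _ wb.
have phiw : phi w = w by exact: (minimal_idempotent _ phimin).
rewrite phiw in pw.
(* The defect in Kadison's inequality at the fixed point [w]: nonnegative, and killed by [phi]
   because [phi] is idempotent; so [rho] kills it too. *)
pose h n := phi (fun n => w n ^+ 2) n - w n ^+ 2.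
have hb : bnd h.
  have := bnd_lin (-1) _ _ w2b pw2b.
  by under eq_fun do rewrite mulN1r addrC.
have h0 n : 0 <= h n by rewrite subr_ge0.
have phih : phi h = (fun=> 0).
  rewrite /h esB // (minimal_idempotent _ phimin) //.
  by apply/funext => n; rewrite subrr.
have := rho_null h hb h0 phih; rewrite /h (esB _ rhoE) //.
move=> H; apply/funext => n; apply/eqP; rewrite -subr_eq0; apply/eqP.
exact: (congr1 (fun f => f n) H).
Qed.

(** Products follow from squares by polarization, the fixed points being closed under sums and
    differences. *)
Lemma multiplicative_idempotent_state_exists : exists2 T : (int -> R) -> int -> R,
  admissible T &
  (forall v, bnd v -> T (T v) = T v) /\
  (forall u v, bnd u -> bnd v -> T u = u -> T v = v ->
     T (fun n => u n * v n) = (fun n => u n * v n)).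
Proof.
have [T TA [Tidem Tsqr]] := idempotent_state_exists.
exists T => //; split=> // u v ub vb Tu Tv; have [TE _] := TA.
have sb : bnd (fun n => u n + v n).
  by have := bnd_lin 1 _ _ ub vb; under eq_fun do rewrite mul1r.
have db : bnd (fun n => u n - v n).
  by have := bnd_lin (-1) _ _ vb ub; under eq_fun do rewrite mulN1r addrC.
have s2b : bnd (fun n => (u n + v n) ^+ 2) by exact: bndM.
have d2b : bnd (fun n => (u n - v n) ^+ 2) by exact: bndM.
have Ts : T (fun n => u n + v n) = (fun n => u n + v n) by rewrite esD // Tu Tv.
have Td : T (fun n => u n - v n) = (fun n => u n - v n) by rewrite esB // Tu Tv.
have E : (fun n => u n * v n) =
    (fun n => 4^-1 * ((u n + v n) ^+ 2 - (u n - v n) ^+ 2)).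
  by apply/funext => n; field.
rewrite E esZ //; last first.
  by have := bnd_lin (-1) _ _ d2b s2b; under eq_fun do rewrite mulN1r addrC.
by rewrite esB // (Tsqr _ sb Ts) (Tsqr _ db Td).
Qed.

End MultiplicativeRange.

(** * The unit circle: density of dyadic roots of unity, and a cube root of unity *)

Section UnitCircle.
Context {R : realType}.
Implicit Types z : R[i].

Lemma complexP z1 z2 : complex.Re z1 = complex.Re z2 ->
  complex.Im z1 = complex.Im z2 -> z1 = z2.
Proof. by case: z1 z2 => [a b] [c d] /= -> ->. Qed.

Lemma normc_ge_Im z : `|complex.Im z|%:C%C <= `|z|.
Proof.
(* Multiplication by i turns the imaginary part into the real part up to sign. *)
have := normc_ge_Re (z * (Complex 0 1)); rewrite normrM.
have -> : `|Complex 0 1 : R[i]| = 1.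
  by rewrite normc_def /= expr0n expr1n add0r sqrtr1.
by case: z => a b; rewrite mulr1 /= mulr0 mulr1 sub0r normrN.
Qed.

Lemma normc_le_ReIm z :
  `|z| <= (`|complex.Re z| + `|complex.Im z|)%:C%C.
Proof.
rewrite normc_def lecR -(ler_pXn2r (n := 2)) ?nnegrE ?sqrtr_ge0 ?addr_ge0 //.
rewrite sqr_sqrtr ?addr_ge0 ?sqr_ge0 // -(real_normK (num_real (complex.Re z))).
rewrite -(real_normK (num_real (complex.Im z))).
have := normr_ge0 (complex.Re z); have := normr_ge0 (complex.Im z); nra.
Qed.

Lemma unit_conj_inv z : `|z| = 1 -> z^-1 = (z^*)%C.
Proof. by move=> z1; rewrite invc_norm z1 expr1n invr1 mul1r. Qed.

Lemma unit_neq0 z : `|z| = 1 -> z != 0.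
Proof. by move=> z1; rewrite -normr_eq0 z1 oner_eq0. Qed.

Lemma norm_exprz_unit z (n : int) : `|z| = 1 -> `|z ^ n| = 1.
Proof.
move=> z1; case: n => n; first by rewrite -exprnP normrX z1 expr1n.
by rewrite -[z ^ _]/(z ^- n.+1) normfV normrX z1 expr1n invr1.
Qed.

Definition cis (t : R) : R[i] := Complex (cos t) (sin t).

Lemma cis_natmul t m : cis t ^+ m = cis (m%:R * t).
Proof.
elim: m => [|m IH]; first by rewrite mul0r /cis cos0 sin0.
rewrite exprS IH /cis -natr1 mulrDl mul1r addrC cosD sinD.
by apply: complexP => /=; ring.
Qed.

Lemma norm_cis t : `|cis t| = 1.
Proof. by rewrite normc_def /= cos2Dsin2 sqrtr1. Qed.

(** The arccosine of the real part serves the upper half circle, its reflection [2 pi - acos x] the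
    lower one. Nonnegativity of the angle permits rounding it down with [truncn]. *)
Lemma cis_surj z : `|z| = 1 -> exists2 t, 0 <= t & z = cis t.
Proof.
case: z => x y; rewrite normc_def /= => /complexI /(congr1 (fun r => r ^+ 2)).
rewrite sqr_sqrtr ?addr_ge0 ?sqr_ge0 // expr1n => xy.
have x1 : -1 <= x <= 1 by apply/andP; split; nra.
have cx : cos (acos x) = x by rewrite acosK // in_itv.
have sx : sin (acos x) = `|y|.
  by rewrite sin_acos // -sqrtr_sqr; congr Num.sqrt; lra.
have [y0|y0] := leP 0 y.
  by exists (acos x); [exact: acos_ge0|rewrite /cis cx sx ger0_norm].
exists (pi *+ 2 - acos x).
  have := acos_lepi x1; have := pi_ge0 R; lra.
rewrite /cis -[cos _]cosN -[sin _]opprK -sinN opprB.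
rewrite -[cos _]cosD2pi -[sin _]sinD2pi subrK cx sx ltr0_norm // opprK //.
Qed.

(** The angle of [mu] is rounded down to a multiple of 2 pi / 2^k, with a mesh below the [d] that
    continuity of sine and cosine supplies at that angle. *)
Lemma dyadic_roots_dense (mu : R[i]) (eps : R[i]) : `|mu| = 1 -> 0 < eps ->
  exists (k : nat) (lam : R[i]), [/\ `|lam| = 1, lam ^+ (2 ^ k) = 1 & `|lam - mu| < eps].
Proof.
move=> /cis_surj[t t0 ->]; case: eps => e e'; rewrite ltcE /= => /andP[/eqP-> e0].
have e20 : 0 < e / 2 by lra.
have /cvgrPdist_lt /(_ _ e20) := @continuous_cos R t.
have /cvgrPdist_lt /(_ _ e20) := @continuous_sin R t.
move=> Hs Hc; have [d /= d0 Hd] := filterI Hs Hc.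
have pi2 : 0 < pi *+ 2 :> R by rewrite pmulrn_lgt0 // pi_gt0.
(* Then 2^k > k > 2 pi / d. *)
pose k := (Num.truncn (pi *+ 2 / d)).+1.
have kd : pi *+ 2 / 2 ^+ k < d.
  rewrite ltr_pdivrMr ?exprn_gt0 // mulrC -ltr_pdivrMr //.
  apply: (lt_trans (truncnS_gt _)).
  by rewrite -natrX ltr_nat ltn_expl.
pose a : R := pi *+ 2 / 2 ^+ k.
have a0 : 0 < a by rewrite divr_gt0 // exprn_gt0.
pose j := Num.truncn (t / a).
have /andP[j1 j2] : j%:R <= t / a < j.+1%:R by apply: truncn_itv; rewrite divr_ge0 // ltW.
exists k, (cis (j%:R * a)); split; first exact: norm_cis.
  rewrite -cis_natmul -exprM mulnC exprM cis_natmul natrX.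
  have -> : 2 ^+ k * a = pi *+ 2 :> R by rewrite mulrC divfK // expf_neq0.
  by rewrite /cis cos2pi sin2pi -[Complex 1 0]/(1 : R[i]) expr1n.
have [|Hsin Hcos] := Hd (j%:R * a).
  rewrite /ball_ /= ltr_norml.
  move: j1 j2; rewrite ler_pdivlMr // ltr_pdivrMr // -natr1 mulrDl mul1r => j1 j2.
  by apply/andP; split; rewrite -/a in kd; lra.
apply: (le_lt_trans (normc_le_ReIm _)); rewrite ltcE /= eqxx /=.
rewrite /= distrC in Hsin; rewrite /= distrC in Hcos; lra.
Qed.

Definition omega : R[i] := Complex (- 2^-1) (Num.sqrt 3 / 2).

Lemma norm_omega : `|omega| = 1.
Proof.
rewrite normc_def /omega /= expr_div_n sqr_sqrtr //.
have -> : (- 2^-1) ^+ 2 + 3 / 2 ^+ 2 = 1 :> R by field.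
by rewrite sqrtr1.
Qed.

Lemma omega_min_poly : 1 + omega + omega ^+ 2 = 0.
Proof.
have s3 : Num.sqrt 3 * Num.sqrt 3 = 3 :> R by rewrite -expr2 sqr_sqrtr.
by apply: complexP; rewrite /omega /= ?expr2 /=; lra.
Qed.

End UnitCircle.

(** * Complexification of the real operator, and its range and spectrum *)

Section Complexification.
Context {R : realType}.
Implicit Types u v w : int -> R[i].

Definition reS v : int -> R := fun n => complex.Re (v n).
Definition imS v : int -> R := fun n => complex.Im (v n).

Lemma boundedP v : bounded v <-> bnd (reS v) /\ bnd (imS v).
Proof.
split=> [[M vM]|[[M vM] [N vN]]].
  have H (x : R) n : x%:C%C <= `|v n| -> x <= complex.Re M.
    by move=> /le_trans /(_ (vM n)); rewrite lecE => /andP[].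
  split; exists (complex.Re M) => n; apply: (H _ n).
    exact: normc_ge_Re.
  exact: normc_ge_Im.
exists (M + N)%:C%C => n; apply: (le_trans (normc_le_ReIm _)).
by rewrite lecR lerD //; [exact: vM|exact: vN].
Qed.

Lemma bounded_lin (a : R[i]) u v : bounded u -> bounded v ->
  bounded (fun n => a * u n + v n).
Proof.
move=> [M uM] [N vN]; exists (`|a| * M + N) => n.
by rewrite (le_trans (ler_normD _ _))// lerD// normrM ler_wpM2l.
Qed.

Lemma bounded_cst (c : R[i]) : bounded (fun=> c).
Proof. by exists `|c|. Qed.

Lemma boundedM u v : bounded u -> bounded v -> bounded (fun n => u n * v n).
Proof.
by move=> [M uM] [N vN]; exists (M * N) => n; rewrite normrM ler_pM.
Qed.

Lemma bounded_sum (N : nat) (c : 'I_N -> R[i]) (F : 'I_N -> int -> R[i]) :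
  (forall i, bounded (F i)) -> bounded (fun n => \sum_(i < N) c i * F i n).
Proof.
elim: N c F => [|N IH] c F Fb.
  by under eq_fun do rewrite big_ord0; exact: bounded_cst.
under eq_fun do rewrite big_ord_recl; apply: bounded_lin => //.
exact: (IH (fun i => c (lift ord0 i)) (fun i => F (lift ord0 i))).
Qed.

Lemma bounded_xl (lam : R[i]) : `|lam| = 1 -> bounded (xl lam).
Proof. by move=> l1; exists 1 => n; rewrite /xl norm_exprz_unit. Qed.

Lemma null_seq_vanishing v : null_seq v -> vanishing (reS v) /\ vanishing (imS v).
Proof.
move=> v0.
suff H (f : R[i] -> R) : (forall z, `|f z|%:C%C <= `|z|) -> vanishing (f \o v).
  by split; [apply: (H (@complex.Re R)); exact: normc_ge_Re
            |apply: (H (@complex.Im R)); exact: normc_ge_Im].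
move=> fle e e0; have [|N vN] := v0 e%:C%C; first by rewrite ltcR.
by exists N => n Nn; rewrite -ltcR (le_lt_trans (fle _)) //; exact: vN.
Qed.

Definition complexify (T : (int -> R) -> int -> R) v : int -> R[i] :=
  fun n => Complex (T (reS v) n) (T (imS v) n).

Variable T : (int -> R) -> int -> R.
Hypothesis TA : admissible T.
Hypothesis T_idem : forall v : int -> R, bnd v -> T (T v) = T v.
Hypothesis T_mul : forall u v : int -> R, bnd u -> bnd v -> T u = u -> T v = v ->
  T (fun n => u n * v n) = (fun n => u n * v n).

Local Notation Phi := (complexify T).
Let TE : equivariant_state T := proj1 TA.

Lemma complexify_fixE v : Phi v = v <-> T (reS v) = reS v /\ T (imS v) = imS v.
Proof.
split=> [E|[E1 E2]].
  by split; apply/funext => n; rewrite -[in RHS]E.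
by apply/funext => n; rewrite /complexify E1 E2; apply: complexP.
Qed.

Lemma complexify_bounded : maps_linf Phi.
Proof.
by move=> v /boundedP[vr vi]; apply/boundedP; split; exact: es_bnd.
Qed.

Lemma complexify_linear : linear_linf Phi.
Proof.
move=> a u v /boundedP[ur ui] /boundedP[vr vi]; apply/funext => n.
have Er : reS (fun n => a * u n + v n) =
    (fun n => complex.Re a * reS u n + (- complex.Im a * imS u n + reS v n)).
  apply/funext => k; rewrite /reS /imS; case: (a) (u k) (v k) => [x y] [c d] [e f] /=.
  by rewrite mulNr addrA.
have Ei : imS (fun n => a * u n + v n) =
    (fun n => complex.Re a * imS u n + (complex.Im a * reS u n + imS v n)).
  apply/funext => k; rewrite /reS /imS; case: (a) (u k) (v k) => [x y] [c d] [e f] /=.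
  ring.
rewrite /complexify Er Ei !(es_lin _ TE) //; try exact: bnd_lin.
by case: (a) => x y; apply: complexP => /=; ring.
Qed.

Lemma complexify_cst (c : R[i]) : Phi (fun=> c) = (fun=> c).
Proof.
by apply/complexify_fixE; split; exact: (es_cst _ TE).
Qed.

Lemma complexifyZ a v : bounded v -> Phi (fun n => a * v n) = (fun n => a * Phi v n).
Proof.
move=> vb; have := complexify_linear a _ _ vb (bounded_cst 0).
under eq_fun do rewrite addr0.
by rewrite complexify_cst => ->; under eq_fun do rewrite addr0.
Qed.

Lemma complexify_sum (N : nat) (c : 'I_N -> R[i]) (F : 'I_N -> int -> R[i]) :
  (forall i, bounded (F i)) ->
  Phi (fun n => \sum_(i < N) c i * F i n) = (fun n => \sum_(i < N) c i * Phi (F i) n).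
Proof.
elim: N c F => [|N IH] c F Fb.
  under eq_fun do rewrite big_ord0; rewrite complexify_cst.
  by under [RHS]eq_fun do rewrite big_ord0.
under eq_fun do rewrite big_ord_recl.
rewrite complexify_linear //; last by apply: bounded_sum.
rewrite (IH (fun i => c (lift ord0 i)) (fun i => F (lift ord0 i))) //.
by under [RHS]eq_fun do rewrite big_ord_recl.
Qed.

Lemma complexify_ge0 v : bounded v -> (forall n, 0 <= v n) -> forall n, 0 <= Phi v n.
Proof.
move=> /boundedP[vr vi] v0 n.
have i0 : imS v = (fun=> 0).
  by apply/funext => k; have := v0 k; rewrite lecE => /andP[/eqP].
rewrite lecE /= i0 es0 // eqxx /=.
by apply: (es_ge0 _ TE) => // k; have := v0 k; rewrite lecE => /andP[].
Qed.

Lemma complexify_cp : completely_positive Phi.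
Proof.
move=> N A Ab Apsd k w.
(* Testing against a constant vector [w] turns the matrix into one nonnegative scalar sequence;
   linearity carries [Phi] inside the double sum. *)
pose G i n := \sum_(j < N) w j * A i j n.
have Gb i : bounded (G i) by exact: bounded_sum.
have E B : \sum_(i < N) \sum_(j < N) (w i)^* * B i j * w j =
    \sum_(i < N) (w i)^* * \sum_(j < N) w j * B i j :> R[i].
  apply: eq_bigr => i _; rewrite mulr_sumr; apply: eq_bigr => j _.
  by rewrite -mulrA [B i j * _]mulrC.
have := complexify_ge0 (fun n => \sum_(i < N) (w i)^* * G i n).
move=> /(_ (bounded_sum _ _ _ Gb)) H.
have {}H : 0 <= Phi (fun n => \sum_(i < N) (w i)^* * G i n) k.
  by apply: H => n; rewrite -E; exact: Apsd.
rewrite complexify_sum // in H.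
rewrite E; congr (0 <= _): H; apply: eq_bigr => i _.
by rewrite /G complexify_sum.
Qed.

Lemma complexify_idempotent : idempotent_linf Phi.
Proof.
move=> v /boundedP[vr vi]; apply/complexify_fixE.
by split; [exact: (T_idem _ vr)|exact: (T_idem _ vi)].
Qed.

Lemma complexify_translate v m : bounded v ->
  Phi (fun n => v (n + m)) = (fun n => Phi v (n + m)).
Proof.
move=> /boundedP[vr vi]; apply/funext => n.
by apply: complexP => /=;
  [have := es_translate _ TE _ m vr|have := es_translate _ TE _ m vi];
  move=> /(congr1 (fun f => f n)).
Qed.

Lemma complexify_rangeE w : in_range Phi w <-> bounded w /\ Phi w = w.
Proof.
split=> [[v [vb <-]]|[wb E]]; last by exists w.
by split; [exact: complexify_bounded|exact: complexify_idempotent].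
Qed.

Lemma complexify_rangeM u v : in_range Phi u -> in_range Phi v ->
  in_range Phi (fun n => u n * v n).
Proof.
move=> /complexify_rangeE[ub /complexify_fixE[ur ui]].
move=> /complexify_rangeE[vb /complexify_fixE[vr vi]].
have /boundedP[urb uib] := ub; have /boundedP[vrb vib] := vb.
apply/complexify_rangeE; split; first exact: boundedM.
apply/complexify_fixE; split.
  have -> : reS (fun n => u n * v n) = (fun n => reS u n * reS v n - imS u n * imS v n).
    by apply/funext => n; rewrite /reS /imS; case: (u n) (v n) => [a b] [c d].
  by rewrite (esB _ TE); [rewrite !T_mul|exact: bndM|exact: bndM].
have -> : imS (fun n => u n * v n) = (fun n => reS u n * imS v n + imS u n * reS v n).
  by apply/funext => n; rewrite /reS /imS; case: (u n) (v n) => [a b] [c d].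
by rewrite (esD _ TE); [rewrite !T_mul|exact: bndM|exact: bndM].
Qed.

Lemma complexify_rangeJ u : in_range Phi u -> in_range Phi (fun n => (u n)^*).
Proof.
move=> /complexify_rangeE[ub /complexify_fixE[ur ui]].
have /boundedP[urb uib] := ub.
have rE : reS (fun n => (u n)^*) = reS u.
  by apply/funext => n; rewrite /reS; case: (u n).
have iE : imS (fun n => (u n)^*) = (fun n => -1 * imS u n).
  by apply/funext => n; rewrite /imS mulN1r; case: (u n).
apply/complexify_rangeE; split.
  have [M uM] := ub; exists M => n; rewrite norm_conjC; exact: uM.
by apply/complexify_fixE; rewrite rE iE (esZ _ TE) // ui.
Qed.

Lemma complexify_range_closed w : bounded w ->
  (forall eps : R[i], 0 < eps ->
     exists u, in_range Phi u /\ forall n, `|w n - u n| <= eps) ->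
  in_range Phi w.
Proof.
move=> wb wlim; apply/complexify_rangeE; split => //.
have /boundedP[wr wi] := wb.
(* A contraction has a closed set of fixed points; this is applied to the real and imaginary parts
   separately. *)
have H (f : int -> R) : bnd f -> (forall e, 0 < e ->
    exists2 g, bnd g /\ T g = g & forall n, `|f n - g n| <= e) -> T f = f.
  move=> fb flim; apply/funext => n; apply/eqP; rewrite -subr_eq0 -normr_eq0.
  rewrite eq_le normr_ge0 andbT; apply/ler_addgt0Pl => e e0; rewrite addr0.
  have [|g [gb Tg] fg] := flim (e / 2); first by lra.
  have : `|T f n - T g n| <= e / 2.
    have := es_norm_le _ TE (fun n => f n - g n) _ fg n.
    by rewrite (esB _ TE).
  rewrite Tg => Tfg; have := fg n; rewrite distrC => gf.
  have -> : T f n - f n = (T f n - g n) + (g n - f n) by ring.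
  by rewrite (le_trans (ler_normD _ _)) //; lra.
apply/complexify_fixE; split; apply: H => // e e0.
  have [|u [/complexify_rangeE[/boundedP[ur ui] /complexify_fixE[Tr Ti]] wu]] := wlim e%:C%C.
    by rewrite ltcR.
  exists (reS u) => // n; rewrite -lecR; apply: le_trans (wu n).
  have := normc_ge_Re (w n - u n); rewrite /reS.
  by case: (w n) (u n) => [a b] [c d].
have [|u [/complexify_rangeE[/boundedP[ur ui] /complexify_fixE[Tr Ti]] wu]] := wlim e%:C%C.
  by rewrite ltcR.
exists (imS u) => // n; rewrite -lecR; apply: le_trans (wu n).
have := normc_ge_Im (w n - u n); rewrite /imS.
by case: (w n) (u n) => [a b] [c d].
Qed.

Lemma complexify_range_Cstar : range_Cstar_subalgebra Phi.
Proof.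
split; first by apply/complexify_rangeE; split; [exact: bounded_cst|exact: complexify_cst].
split.
  move=> a u v /complexify_rangeE[ub Eu] /complexify_rangeE[vb Ev].
  apply/complexify_rangeE; split; first exact: bounded_lin.
  by rewrite complexify_linear // Eu Ev.
split; first exact: complexify_rangeM.
split; first exact: complexify_rangeJ.
exact: complexify_range_closed.
Qed.

Lemma complexify_kills_c0 : kills_c0 Phi.
Proof.
move=> v /boundedP[vr vi] /null_seq_vanishing[rv iv]; have [_ TP] := TA.
apply/funext => n.
by rewrite /complexify (TP _ _ vr (prescribed_vanishing _ rv))
  (TP _ _ vi (prescribed_vanishing _ iv)).
Qed.

(** Translating x_lambda by m multiplies it by lambda^m, so equivariance makes it an eigenvector
    with eigenvalue [c]. Idempotence gives c^2 = c, so a nonzero [c] equals 1. *)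
Lemma sigmaPhiE (lam : R[i]) : sigmaPhi Phi lam <-> `|lam| = 1 /\ in_range Phi (xl lam).
Proof.
rewrite /sigmaPhi /coefc; split=> -[l1 H]; split=> //; last first.
  move/complexify_rangeE: H => [_ ->]; rewrite /xl expr0z; exact: oner_neq0.
have l0 := unit_neq0 _ l1; have xb := bounded_xl _ l1.
set c := Phi (xl lam) 0 in H.
have E : Phi (xl lam) = (fun n => c * xl lam n).
  apply/funext => m.
  have /(congr1 (fun f => f 0)) := complexify_translate _ m xb.
  rewrite add0r => <-.
  have -> : (fun n => xl lam (n + m)) = (fun n => lam ^ m * xl lam n).
    by apply/funext => n; rewrite /xl expfzDr // mulrC.
  by rewrite complexifyZ // mulrC.
have : c * c = c.
  have /(congr1 (fun f => f 0)) := complexify_idempotent _ xb.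
  by rewrite {1}E complexifyZ.
rewrite -[X in _ = X -> _]mulr1 => /(mulfI H) c1.
apply/complexify_rangeE; split=> //; rewrite E c1.
by apply/funext => n; rewrite mul1r.
Qed.

Lemma complexify_root_of_unity (lam : R[i]) k : `|lam| = 1 -> lam ^+ (2 ^ k) = 1 ->
  in_range Phi (xl lam).
Proof.
move=> l1 lk; have xb := bounded_xl _ l1; have /boundedP[xr xi] := xb.
have per n : xl lam (n + 2 ^+ k) = xl lam n.
  by rewrite /xl expfzDr ?unit_neq0 // -natrX natz -exprnP lk mulr1.
apply/complexify_rangeE; split=> //; apply/complexify_fixE.
by split; apply: (admissible_fixes _ TA) => //; exists k => n; rewrite /reS /imS per.
Qed.

Lemma complexify_omega : Phi (xl omega) = (fun=> 0).
Proof.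
have /boundedP[xr xi] := bounded_xl _ (@norm_omega R).
have [_ TP] := TA.
have sum0 n : xl (omega : R[i]) n + xl omega (n + 1) + xl omega (n + 2) = 0.
  rewrite /xl !expfzDr ?unit_neq0 ?norm_omega // expr1z -expr2.
  rewrite -[X in X + _ + _]mulr1 -!mulrDr.
  by rewrite omega_min_poly mulr0.
apply/funext => n; rewrite /complexify.
rewrite (TP _ (fun=> 0)) // ?(TP _ (fun=> 0)) //; apply: prescribed_period3 => m.
  have := congr1 (@complex.Im R) (sum0 m); rewrite /imS.
  by case: (xl _ _) (xl _ _) (xl _ _) => [a b] [c d] [e f].
have := congr1 (@complex.Re R) (sum0 m); rewrite /reS.
by case: (xl _ _) (xl _ _) (xl _ _) => [a b] [c d] [e f].
Qed.

Lemma complexify_not_homomorphism : ~ homomorphism Phi.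
Proof.
move=> H; have ob := bounded_xl _ (@norm_omega R).
(* A unital homomorphism cannot kill an invertible element. *)
have no_inverse v : bounded v -> (fun n => xl omega n * v n) <> (fun=> 1).
  move=> vb E.
  have := etrans (esym (complexify_cst 1)) (etrans (congr1 Phi (esym E)) (H _ _ ob vb)).
  rewrite complexify_omega => /(congr1 (fun f => f 0)) /eqP.
  by rewrite mul0r oner_eq0.
apply: (no_inverse (xl omega^-1)).
  by apply: bounded_xl; rewrite normfV norm_omega invr1.
apply/funext => n; rewrite /xl -expfzMl divff ?exp1rz //.
by rewrite unit_neq0 // norm_omega.
Qed.

Lemma complexify_sigma : dense_proper_subgroup_T (sigmaPhi Phi).
Proof.
split; first by move=> lam [].
split.
  apply/sigmaPhiE; split; first exact: normr1.
  by apply: (complexify_root_of_unity _ 0); rewrite ?normr1 ?expr1.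
split.
  move=> a b /sigmaPhiE[a1 ra] /sigmaPhiE[b1 rb].
  apply/sigmaPhiE; split; first by rewrite normrM a1 b1 mulr1.
  have -> : xl (a * b) = (fun n => xl a n * xl b n).
    by apply/funext => n; rewrite /xl expfzMl.
  exact: complexify_rangeM.
split.
  move=> a /sigmaPhiE[a1 ra].
  apply/sigmaPhiE; split; first by rewrite normfV a1 invr1.
  (* On the circle inversion is conjugation, so closure of sigma under inverses comes from the range
     being closed under the involution. *)
  have -> : xl a^-1 = (fun n => (xl a n)^*).
    apply/funext => n; rewrite /xl exprz_inv -invr_expz.
    exact: unit_conj_inv (norm_exprz_unit _ _ a1).
  exact: complexify_rangeJ.
split.
  move=> mu mu1 eps e0; have [k [lam [l1 lk d]]] := dyadic_roots_dense _ _ mu1 e0.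
  by exists lam; split=> //; apply/sigmaPhiE; split=> //; exact: complexify_root_of_unity lk.
exists omega; split; first exact: norm_omega.
by rewrite /sigmaPhi /coefc complexify_omega eqxx => -[].
Qed.

End Complexification.

Theorem theorem2p14 (R : realType) :
  exists Phi : (int -> R[i]) -> (int -> R[i]),
    maps_linf Phi /\ linear_linf Phi /\ unital Phi /\ completely_positive Phi /\
    idempotent_linf Phi /\ commutes_B Phi /\ range_Cstar_subalgebra Phi /\
    ~ homomorphism Phi /\ kills_c0 Phi /\
    dense_proper_subgroup_T (sigmaPhi Phi).
Proof.
have [T TA [T_idem T_mul]] := @multiplicative_idempotent_state_exists R.
exists (complexify T).
split; first exact: complexify_bounded.
split; first exact: complexify_linear.
split; first exact: complexify_cst.
split; first exact: complexify_cp.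
split; first exact: complexify_idempotent.
split; first by move=> v; exact: complexify_translate.
split; first exact: complexify_range_Cstar.
split; first exact: complexify_not_homomorphism.
split; first exact: complexify_kills_c0.
exact: complexify_sigma.
Qed.
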